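(* Let $\mathcal C$ be a small category. If $j:A\to B$ is a cofibration and $p:X\to Y$ is a fibration in $\mathcal E^{\mathcal C^{\mathrm{op}}}$ (with the pointwise fibration structure), then the induced map $$(j^*,p_* ): \operatorname{Hom}(B,X) \to \operatorname{Hom}(A,X)\times_{\operatorname{Hom}(A,Y)} \operatorname{Hom}(B,Y),\qquad \phi\mapsto(\phi\circ j,\ p\circ\phi),$$ is a fibration in $\mathcal E$, which is acyclic if $j$ or $p$ is acyclic.
   Context: A partitioned set is a set $X$ with an equivalence relation $\sim$. A morphism $f:X\to Y$ of partitioned sets is a map of sets with $f(x)\sim f(x')$ whenever $x\sim x'$. $\mathcal E$ is the category of partitioned sets and their morphisms. A morphism $f:X\to Y$ in $\mathcal E$ is: a cofibration if it is injective; a fibration if it maps each equivalence class of $X$ onto an equivalence class of $Y$; acyclic (a weak equivalence) if the induced map of quotient sets $X/\!\sim\;\to Y/\!\sim$ is a bijection. $\mathcal E^{\mathcal C^{\mathrm{op}}}$ is the category of $\mathcal E$-valued presheaves on $\mathcal C$, with the model structure (pointwise fibration structure) in which a map $\phi$ is a weak equivalence (acyclic), respectively a fibration, if $\phi_C$ is one in $\mathcal E$ for every object $C$ of $\mathcal C$, and cofibrations are the maps with the left lifting property with respect to all acyclic fibrations. For presheaves $X,Y$, $\operatorname{Hom}(X,Y)$ is the partitioned set of all presheaf morphisms $X\to Y$ with $\phi\sim\psi$ if for every object $C$ of $\mathcal C$ and every $x\in X(C)$, $\phi_C(x)\sim\psi_C(x)$ in $Y(C)$. The fibre product is the pullback in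 $\mathcal E$ along $p_*:\operatorname{Hom}(A,X)\to\operatorname{Hom}(A,Y)$ (postcomposition by $p$) and $j^*:\operatorname{Hom}(B,Y)\to\operatorname{Hom}(A,Y)$ (precomposition by $j$); it is the set-theoretic pullback with $(u,v)\sim(u',v')$ if and only if $u\sim u'$ and $v\sim v'$. *)

(* Defs.v *)
From Stdlib Require Export RelationClasses.
From mathcomp Require Export all_boot.
From mathcomp Require Export boolp classical_sets.

Set Implicit Arguments.
Unset Strict Implicit.
Unset Printing Implicit Defensive.

Local Open Scope classical_set_scope.

Record pset : Type := PSet {
  pset_sort :> Type;
  peq : pset_sort -> pset_sort -> Prop;
  peqP : Equivalence peq }.

Declare Scope pset_scope.
Delimit Scope pset_scope with pset.
Local Open Scope pset_scope.
Notation "x ~~~ y" := (peq x y) (at level 70, no associativity) : pset_scope.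

Record pset_hom (X Y : pset) : Type := PSetHom {
  pset_fun :> X -> Y;
  pset_funP : forall x x' : X, x ~~~ x' -> pset_fun x ~~~ pset_fun x' }.

Lemma pset_hom_ext (X Y : pset) (f g : pset_hom X Y) : f =1 g -> f = g.
Proof.
case: f g => [f Hf] [g Hg] /= /funext fg; case: g / fg Hg => Hg.
by congr PSetHom; exact: Prop_irrelevance.
Qed.

Definition pset_id (X : pset) : pset_hom X X :=
  @PSetHom X X id (fun _ _ xx' => xx').

Definition pset_comp (X Y Z : pset) (g : pset_hom Y Z) (f : pset_hom X Y) :
    pset_hom X Z :=
  @PSetHom X Z (g \o f) (fun _ _ xx' => pset_funP g (pset_funP f xx')).

Definition pclass (X : pset) (x : X) : set X := [set x' | x ~~~ x'].

Definition is_pclass (X : pset) (P : set X) : Prop := exists x, P = pclass x.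

(* The quotient X/~, realized as the type of all equivalence classes. *)
Definition quotient (X : pset) : Type := {P : set X | is_pclass P}.

Definition quotient_pi (X : pset) (x : X) : quotient X :=
  exist _ (pclass x) (ex_intro _ x erefl).

Lemma saturate_pclass (X Y : pset) (f : pset_hom X Y) (x : X) :
  [set y | exists2 x', pclass x x' & f x' ~~~ y] = pclass (f x).
Proof.
have [rX _ _] := peqP X; have [_ _ tY] := peqP Y.
apply/seteqP; split=> y /= => [[x' xx' fx'y]|fxy].
  exact: tY (pset_funP f xx') fx'y.
by exists x => //; exact: rX.
Qed.

Lemma quotient_fun_subproof (X Y : pset) (f : pset_hom X Y) (q : quotient X) :
  is_pclass [set y | exists2 x, sval q x & f x ~~~ y].
Proof.
case: q => P [x xP]; rewrite /= xP; exists (f x); exact: saturate_pclass.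
Qed.

(* The map X/~ -> Y/~ induced by f: it sends a class to the unique class
   containing its image under f, see quotient_funE. *)
Definition quotient_fun (X Y : pset) (f : pset_hom X Y) (q : quotient X) :
    quotient Y :=
  exist _ _ (quotient_fun_subproof f q).

Lemma quotient_funE (X Y : pset) (f : pset_hom X Y) (x : X) :
  quotient_fun f (quotient_pi x) = quotient_pi (f x).
Proof. by apply: eq_exist; exact: saturate_pclass. Qed.

Definition fibration (X Y : pset) (f : pset_hom X Y) : Prop :=
  forall P : set X, is_pclass P -> is_pclass (f @` P).

Definition acyclic (X Y : pset) (f : pset_hom X Y) : Prop :=
  bijective (quotient_fun f).

Section Pullback.
Variables (X Y Z : pset) (f : pset_hom X Z) (g : pset_hom Y Z).

Definition pullback_sort : Type := {xy : X * Y | f xy.1 = g xy.2}.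

Definition pullback_eq (s t : pullback_sort) : Prop :=
  (sval s).1 ~~~ (sval t).1 /\ (sval s).2 ~~~ (sval t).2.

Lemma pullback_eqP : Equivalence pullback_eq.
Proof.
have [rX sX tX] := peqP X; have [rY sY tY] := peqP Y; split.
- by move=> s; split.
- by move=> s t [? ?]; split; [exact: sX | exact: sY].
- move=> s t u [? ?] [? ?].
  by split; [apply: tX; eassumption | apply: tY; eassumption].
Qed.

Definition pullback : pset := PSet pullback_eqP.

Variables (W : pset) (u : pset_hom W X) (v : pset_hom W Y).
Hypothesis uv : forall w, f (u w) = g (v w).

Definition pullback_pair_fun (w : W) : pullback :=
  exist (fun xy : X * Y => f xy.1 = g xy.2) (u w, v w) (uv w).

Lemma pullback_pair_funP (w w' : W) :
  w ~~~ w' -> pullback_pair_fun w ~~~ pullback_pair_fun w'.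
Proof. by move=> ww'; split; exact: pset_funP. Qed.

(* The map (u, v) : W -> X x_Z Y. *)
Definition pullback_pair : pset_hom W pullback := PSetHom pullback_pair_funP.

End Pullback.

(* The types of objects and of morphisms are kept in the universe of the
   carriers of partitioned sets, as required for [Hom] below to be a [pset];
   [cat_comp g f] is "g after f". *)
Record small_category : Type := SmallCategory {
  cat_obj :> Type;
  cat_hom : cat_obj -> cat_obj -> Type;
  cat_id : forall c, cat_hom c c;
  cat_comp : forall c d e, cat_hom d e -> cat_hom c d -> cat_hom c e;
  cat_comp_idl : forall c d (f : cat_hom c d), cat_comp (cat_id d) f = f;
  cat_comp_idr : forall c d (f : cat_hom c d), cat_comp f (cat_id c) = f;
  cat_compA : forall b c d e
      (h : cat_hom d e) (g : cat_hom c d) (f : cat_hom b c),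
    cat_comp h (cat_comp g f) = cat_comp (cat_comp h g) f }.

(* Functors from C^op to partitioned sets. *)
Record presheaf (C : small_category) : Type := Presheaf {
  psh_obj :> C -> pset;
  psh_map : forall c d : C, cat_hom c d -> pset_hom (psh_obj d) (psh_obj c);
  psh_map_id : forall c : C, psh_map (cat_id c) = pset_id (psh_obj c);
  psh_map_comp : forall (c d e : C) (g : cat_hom d e) (f : cat_hom c d),
    psh_map (cat_comp g f) = pset_comp (psh_map f) (psh_map g) }.

Record psh_hom (C : small_category) (X Y : presheaf C) : Type := PshHom {
  psh_fun :> forall c : C, pset_hom (X c) (Y c);
  psh_funP : forall (c d : C) (f : cat_hom c d),
    pset_comp (psh_fun c) (psh_map X f) =
    pset_comp (psh_map Y f) (psh_fun d) }.

Lemma psh_hom_ext (C : small_category) (X Y : presheaf C)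
    (phi psi : psh_hom X Y) : (forall c, phi c =1 psi c) -> phi = psi.
Proof.
case: phi psi => [phi Hphi] [psi Hpsi] /= E.
have e : phi = psi.
  by apply: functional_extensionality_dep => c; apply: pset_hom_ext; exact: E.
case: psi / e Hpsi {E} => Hpsi; congr PshHom; exact: Prop_irrelevance.
Qed.

Lemma psh_comp_subproof (C : small_category) (X Y Z : presheaf C)
    (psi : psh_hom Y Z) (phi : psh_hom X Y) (c d : C) (f : cat_hom c d) :
  pset_comp (pset_comp (psi c) (phi c)) (psh_map X f) =
  pset_comp (psh_map Z f) (pset_comp (psi d) (phi d)).
Proof.
apply: pset_hom_ext => x /=.
have /= -> := congr1 (fun h : pset_hom _ _ => h x) (psh_funP phi f).
by have /= -> := congr1 (fun h : pset_hom _ _ => h (phi d x)) (psh_funP psi f).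
Qed.

Definition psh_comp (C : small_category) (X Y Z : presheaf C)
    (psi : psh_hom Y Z) (phi : psh_hom X Y) : psh_hom X Z :=
  PshHom (psh_comp_subproof psi phi).

Definition psh_fibration (C : small_category) (X Y : presheaf C)
    (p : psh_hom X Y) : Prop := forall c, fibration (p c).

Definition psh_acyclic (C : small_category) (X Y : presheaf C)
    (p : psh_hom X Y) : Prop := forall c, acyclic (p c).

Definition has_lifting (C : small_category) (A B X Y : presheaf C)
    (j : psh_hom A B) (p : psh_hom X Y) : Prop :=
  forall (u : psh_hom A X) (v : psh_hom B Y),
    psh_comp p u = psh_comp v j ->
    exists h : psh_hom B X, psh_comp h j = u /\ psh_comp p h = v.

Definition psh_cofibration (C : small_category) (A B : presheaf C)
    (j : psh_hom A B) : Prop :=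
  forall (X Y : presheaf C) (p : psh_hom X Y),
    psh_fibration p -> psh_acyclic p -> has_lifting j p.

Section Hom.
Variable C : small_category.

Definition Hom_eq (X Y : presheaf C) (phi psi : psh_hom X Y) : Prop :=
  forall (c : C) (x : X c), phi c x ~~~ psi c x.

Lemma Hom_eqP (X Y : presheaf C) : Equivalence (@Hom_eq X Y).
Proof.
split.
- by move=> f c x; have [rf _ _] := peqP (Y c); exact: rf.
- by move=> f g fg c x; have [_ sy _] := peqP (Y c); exact: sy.
- move=> f g h fg gh c x; have [_ _ tr] := peqP (Y c).
  exact: tr (fg c x) (gh c x).
Qed.

Definition Hom (X Y : presheaf C) : pset := PSet (Hom_eqP X Y).

Lemma postcomp_subproof (A X Y : presheaf C) (p : psh_hom X Y)
    (phi psi : Hom A X) :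
  phi ~~~ psi -> (psh_comp p phi : Hom A Y) ~~~ psh_comp p psi.
Proof. by move=> e c x; exact: (pset_funP (p c) (e c x)). Qed.

Definition postcomp (A X Y : presheaf C) (p : psh_hom X Y) :
    pset_hom (Hom A X) (Hom A Y) :=
  @PSetHom (Hom A X) (Hom A Y) (psh_comp p) (@postcomp_subproof A X Y p).

Lemma precomp_subproof (A B Y : presheaf C) (j : psh_hom A B)
    (phi psi : Hom B Y) :
  phi ~~~ psi -> (psh_comp phi j : Hom A Y) ~~~ psh_comp psi j.
Proof. by move=> e c x; exact: e. Qed.

Definition precomp (A B Y : presheaf C) (j : psh_hom A B) :
    pset_hom (Hom B Y) (Hom A Y) :=
  @PSetHom (Hom B Y) (Hom A Y) (fun phi => psh_comp phi j)
    (@precomp_subproof A B Y j).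

Lemma pullback_hom_subproof (A B X Y : presheaf C)
    (j : psh_hom A B) (p : psh_hom X Y) (phi : Hom B X) :
  postcomp A p (precomp X j phi) = precomp Y j (postcomp B p phi).
Proof. exact: psh_hom_ext. Qed.

(* (j^*, p_* ) : Hom(B, X) -> Hom(A, X) x_Hom(A, Y) Hom(B, Y). *)
Definition pullback_hom (A B X Y : presheaf C)
    (j : psh_hom A B) (p : psh_hom X Y) :
    pset_hom (Hom B X) (pullback (postcomp A p) (precomp Y j)) :=
  pullback_pair (pullback_hom_subproof j p).

End Hom.

(* Main.v *)
(* For a map f : X -> Y of presheaves let M(f)(c) be the set of pairs (x, y)
   with f x ~ y, two pairs being equivalent iff their first components are.
   The projection M(f) -> Y is a fibration, acyclic if f is; and if p : X -> Y
   is a fibration, then M(id_X) -> M(p), (x, x') |-> (x, p x'), is an acyclic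
   fibration. Lifting j against the latter moves a map phi : B -> X to an
   equivalent one with prescribed restriction to A and prescribed image in Y.
   If j is acyclic, lifting j against M(j) -> B gives r : B -> A with r j = id
   and j r ~ id, and (u, v) is then equivalent to the image of u r. *)
Require Import Defs.

Set Implicit Arguments.
Unset Strict Implicit.
Unset Printing Implicit Defensive.

Local Open Scope classical_set_scope.
Local Open Scope pset_scope.

(** * Elementwise criteria for fibrations and acyclic maps *)

Section PartitionedSets.
Implicit Types X Y : pset.

Lemma peq_refl X (x : X) : x ~~~ x.
Proof. by have [rX _ _] := peqP X; exact: rX. Qed.

Lemma peq_sym X (x y : X) : x ~~~ y -> y ~~~ x.
Proof. by have [_ sX _] := peqP X; exact: sX. Qed.

Lemma peq_trans X (y x z : X) : x ~~~ y -> y ~~~ z -> x ~~~ z.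
Proof. by have [_ _ tX] := peqP X; exact: tX. Qed.

Lemma pclass_eq X (x y : X) : pclass x = pclass y <-> x ~~~ y.
Proof.
split=> [E|xy]; first by have : pclass y y := peq_refl y; rewrite -E.
apply/seteqP; split=> z /= h; first exact: peq_trans (peq_sym xy) h.
exact: peq_trans xy h.
Qed.

Lemma quotient_pi_eq X (x y : X) : quotient_pi x = quotient_pi y <-> x ~~~ y.
Proof.
split=> [/(congr1 sval) /= /pclass_eq //|xy].
by apply: eq_exist; apply/pclass_eq.
Qed.

Lemma quotient_pi_surj X (q : quotient X) : exists x, q = quotient_pi x.
Proof. by case: q => P [x Px]; exists x; exact: eq_exist. Qed.

(** The image of the class of [x] contains [f x], so if it is a class at all, it is the class of
    [f x]. *)
Lemma fibrationP X Y (f : pset_hom X Y) :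
  fibration f <->
  forall x y, f x ~~~ y -> exists2 x', x ~~~ x' & f x' = y.
Proof.
split=> [fibf x y fxy|lift P [x ->]].
  have [|y0 E] := fibf (pclass x); first by exists x.
  have : (f @` pclass x) (f x) by exists x => //; exact: peq_refl.
  rewrite E => /= y0fx.
  by have : pclass y0 y := peq_trans y0fx fxy; rewrite -E => -[x' ? ?]; exists x'.
exists (f x); apply/seteqP; split=> y /=; last by case/lift=> x' ? ?; exists x'.
by case=> x' xx' <-; exact: pset_funP.
Qed.

Lemma acyclicP X Y (f : pset_hom X Y) :
  acyclic f <->
  (forall x x', f x ~~~ f x' -> x ~~~ x') /\ (forall y, exists x, f x ~~~ y).
Proof.
split=> [bijf|[inj surj]].
  split=> [x x' fxx'|y].
    apply/quotient_pi_eq/(bij_inj bijf); rewrite !quotient_funE.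
    exact/quotient_pi_eq.
  have [g _ gK] := bijf; have [x gx] := quotient_pi_surj (g (quotient_pi y)).
  by exists x; apply/quotient_pi_eq; rewrite -quotient_funE -gx gK.
have surjq q : exists r, quotient_fun f r = q.
  have [y ->] := quotient_pi_surj q; have [x fxy] := surj y.
  by exists (quotient_pi x); rewrite quotient_funE; apply/quotient_pi_eq.
have injq : injective (quotient_fun f).
  move=> q r; have [x ->] := quotient_pi_surj q; have [y ->] := quotient_pi_surj r.
  by rewrite !quotient_funE => /quotient_pi_eq /inj /quotient_pi_eq.
(* The inverse on quotients picks a preimage of each class by choice. *)
exists (fun q => sval (cid (surjq q))) => q; last by case: cid.
by case: cid => r /= /injq.
Qed.

End PartitionedSets.

Lemma psh_nat (C : small_category) (X Y : presheaf C) (phi : psh_hom X Y)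
    (c d : C) (f : cat_hom c d) (x : X d) :
  phi c (psh_map X f x) = psh_map Y f (phi d x).
Proof. exact: (congr1 (fun h : pset_hom _ _ => h x) (psh_funP phi f)). Qed.

Lemma psh_comp_eq (C : small_category) (X Y Y' Z : presheaf C)
    (f : psh_hom Y Z) (g : psh_hom X Y) (f' : psh_hom Y' Z) (g' : psh_hom X Y')
    (c : C) (x : X c) :
  psh_comp f g = psh_comp f' g' -> f c (g c x) = f' c (g' c x).
Proof. exact: (congr1 (fun h : psh_hom _ _ => h c x)). Qed.

Definition psh_id (C : small_category) (X : presheaf C) : psh_hom X X :=
  @PshHom C X X (fun c => pset_id (X c))
    (fun c d f => pset_hom_ext (fun x => erefl)).

(** * The mapping path presheaf and its projections *)

Section MappingPath.
Variables (C : small_category) (X Y : presheaf C) (f : psh_hom X Y).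

(** Analogue of the mapping path space: an equivalence [f x ~~~ y] plays the role of a path from
    [f x] to [y]. *)
Definition mpath_sort (c : C) : Type :=
  {xy : X c * Y c | f c xy.1 ~~~ xy.2}.

Definition mpath_eq c (s t : mpath_sort c) : Prop := (sval s).1 ~~~ (sval t).1.

Lemma mpath_eqP c : Equivalence (@mpath_eq c).
Proof.
split=> [s|s t|s t u]; [exact: peq_refl|exact: peq_sym|exact: peq_trans].
Qed.

Definition mpath_obj c : pset := PSet (mpath_eqP c).

Lemma mpath_map_subproof c d (h : cat_hom c d) (s : mpath_obj d) :
  f c (psh_map X h (sval s).1) ~~~ psh_map Y h (sval s).2.
Proof. by rewrite psh_nat; apply: pset_funP; exact: (svalP s). Qed.

Definition mpath_map c d (h : cat_hom c d) : pset_hom (mpath_obj d) (mpath_obj c) :=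
  @PSetHom (mpath_obj d) (mpath_obj c)
    (fun s => exist _ (psh_map X h (sval s).1, psh_map Y h (sval s).2)
                      (mpath_map_subproof h s))
    (fun s t st => pset_funP (psh_map X h) st).

Lemma mpath_map_id c : mpath_map (cat_id c) = pset_id (mpath_obj c).
Proof.
apply: pset_hom_ext => -[[x y] xy]; apply: eq_exist => /=.
by rewrite !psh_map_id.
Qed.

Lemma mpath_map_comp (c d e : C) (g : cat_hom d e) (h : cat_hom c d) :
  mpath_map (cat_comp g h) = pset_comp (mpath_map h) (mpath_map g).
Proof.
apply: pset_hom_ext => -[[x y] xy]; apply: eq_exist => /=.
by rewrite !psh_map_comp.
Qed.

Definition mpath : presheaf C := Presheaf mpath_map_id mpath_map_comp.

Definition mpath_fst : psh_hom mpath X :=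
  @PshHom C mpath X
    (fun c => @PSetHom (mpath c) (X c) (fun s => (sval s).1) (fun s t st => st))
    (fun c d h => pset_hom_ext (fun s => erefl)).

Lemma mpath_peq c (s : mpath c) : f c (sval s).1 ~~~ (sval s).2.
Proof. exact: svalP s. Qed.

(** Each second component is equivalent to the image under [f] of the first, so comparing first
    components is enough. *)
Lemma mpath_snd_subproof c (s t : mpath c) :
  s ~~~ t -> (sval s).2 ~~~ (sval t).2.
Proof.
move=> st; apply: peq_trans (mpath_peq t).
exact: peq_trans (peq_sym (mpath_peq s)) (pset_funP (f c) st).
Qed.

Definition mpath_snd_fun c : pset_hom (mpath c) (Y c) :=
  @PSetHom (mpath c) (Y c) (fun s => (sval s).2) (@mpath_snd_subproof c).

Lemma mpath_snd_funP c d (h : cat_hom c d) :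
  pset_comp (mpath_snd_fun c) (psh_map mpath h) =
  pset_comp (psh_map Y h) (mpath_snd_fun d).
Proof. exact: pset_hom_ext. Qed.

Definition mpath_snd : psh_hom mpath Y := PshHom mpath_snd_funP.

Section Pair.
Variables (Z : presheaf C) (u : psh_hom Z X) (v : psh_hom Z Y).
Hypothesis uv : forall c (z : Z c), f c (u c z) ~~~ v c z.

Definition mpath_pair_fun c : pset_hom (Z c) (mpath c) :=
  @PSetHom (Z c) (mpath c)
    (fun z => exist (fun xy : X c * Y c => f c xy.1 ~~~ xy.2)
                    (u c z, v c z) (uv z))
    (fun z z' zz' => pset_funP (u c) zz').

Lemma mpath_pair_funP c d (h : cat_hom c d) :
  pset_comp (mpath_pair_fun c) (psh_map Z h) =
  pset_comp (psh_map mpath h) (mpath_pair_fun d).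
Proof.
by apply: pset_hom_ext => z; apply: eq_exist => /=; rewrite !psh_nat.
Qed.

Definition mpath_pair : psh_hom Z mpath := PshHom mpath_pair_funP.

End Pair.

Lemma mpath_snd_fibration : psh_fibration mpath_snd.
Proof.
move=> c; apply/fibrationP => -[[x y] /= xy] y' yy'.
by exists (exist _ (x, y') (peq_trans xy yy')) => //; exact: peq_refl.
Qed.

(** Up to equivalence, [mpath_snd] is [f] after [mpath_fst]; both halves of the criterion are
    inherited from [f]. *)
Lemma mpath_snd_acyclic : psh_acyclic f -> psh_acyclic mpath_snd.
Proof.
move=> acf c; have /acyclicP[inj surj] := acf c; apply/acyclicP; split=> [s t st|y].
  apply: inj; apply: peq_trans (mpath_peq s) _.
  exact: peq_trans st (peq_sym (mpath_peq t)).
by have [x fxy] := surj y; exists (exist _ (x, y) fxy); exact: peq_refl.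
Qed.

End MappingPath.

(** * Comparison of the path object of [X] with the mapping path presheaf of [p] *)

Section PathComparison.
Variables (C : small_category) (X Y : presheaf C) (p : psh_hom X Y).

Lemma path_compare_subproof c (s : mpath (psh_id X) c) :
  p c (mpath_fst _ c s) ~~~ psh_comp p (mpath_snd _) c s.
Proof. exact: pset_funP (mpath_peq s). Qed.

Definition path_compare : psh_hom (mpath (psh_id X)) (mpath p) :=
  mpath_pair path_compare_subproof.

Hypothesis fib : psh_fibration p.

Lemma path_compare_surj c (t : mpath p c) : exists s, path_compare c s = t.
Proof.
case: t => -[x y] /= pxy; have [x' xx' px'] := proj1 (fibrationP _) (@fib c) _ _ pxy.
by exists (exist _ (x, x') xx'); apply: eq_exist; rewrite /= px'.
Qed.

(** Both relations see only first components, which [path_compare] keeps; hence it reflects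
    equivalence by definition. *)
Lemma path_compare_acyclic : psh_acyclic path_compare.
Proof.
move=> c; apply/acyclicP; split=> // t.
by have [s <-] := path_compare_surj t; exists s; exact: peq_refl.
Qed.

(** Since [path_compare] reflects equivalence, any preimage of [t] is a valid lift. *)
Lemma path_compare_fibration : psh_fibration path_compare.
Proof.
by move=> c; apply/fibrationP => s t; have [s' <-] := path_compare_surj t; exists s'.
Qed.

End PathComparison.

(** * Consequences of the lifting property of [j] *)

Section Cofibration.
Variables (C : small_category) (A B : presheaf C) (j : psh_hom A B).
Hypothesis cofj : psh_cofibration j.

Lemma cofibration_lift_peq (X Y : presheaf C) (p : psh_hom X Y)
    (phi : Hom B X) (u : Hom A X) (v : Hom B Y) :
    psh_fibration p -> psh_comp p u = psh_comp v j ->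
    (psh_comp phi j : Hom A X) ~~~ u -> (psh_comp p phi : Hom B Y) ~~~ v ->
  exists psi : Hom B X, [/\ phi ~~~ psi, psh_comp psi j = u & psh_comp p psi = v].
Proof.
move=> fibp puvj phiu phiv.
(* The square to be filled has top [x |-> (phi (j x), u x)] and bottom [y |-> (phi y, v y)]; [psi]
   is the second component of the filler. *)
pose a := mpath_pair (f := psh_id X) phiu.
pose b := mpath_pair (f := p) phiv.
have [|h [hj ph]] := cofj (path_compare_fibration fibp)
    (path_compare_acyclic fibp) (u := a) (v := b).
  apply: psh_hom_ext => c x; apply: eq_exist => /=.
  by rewrite (psh_comp_eq x puvj).
have hj_ c x : h c (j c x) = a c x by rewrite -hj.
have ph_ c x : path_compare p c (h c x) = b c x by rewrite -ph.
exists (psh_comp (mpath_snd _) h); split.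
(* The lower triangle forces the first component of [h] to be [phi], and the two components are
   equivalent. *)
- move=> c x; have := mpath_peq (h c x).
  by have /= -> := congr1 (fun s => (sval s).1) (ph_ c x).
- by apply: psh_hom_ext => c x /=; rewrite hj_.
- by apply: psh_hom_ext => c x; have := congr1 (fun s => (sval s).2) (ph_ c x).
Qed.

Lemma acyclic_cofibration_retraction : psh_acyclic j ->
  exists r : psh_hom B A,
    psh_comp r j = psh_id A /\ (psh_comp j r : Hom B B) ~~~ psh_id B.
Proof.
move=> acj.
(* Here [a] is [x |-> (x, j x)]. A lift of the identity of [B] has the form [y |-> (r y, y)] with
   [j (r y) ~~~ y]. *)
pose a := mpath_pair (f := j) (u := psh_id A) (v := j) (fun c x => peq_refl _).
have [|h [hj sh]] := cofj (@mpath_snd_fibration _ _ _ j) (mpath_snd_acyclic acj)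
    (u := a) (v := psh_id B); first exact: psh_hom_ext.
have hj_ c x : h c (j c x) = a c x by rewrite -hj.
have sh_ c x : (sval (h c x)).2 = x.
  exact: (congr1 (fun k : psh_hom _ _ => k c x) sh).
exists (psh_comp (mpath_fst j) h); split.
  by apply: psh_hom_ext => c x /=; rewrite hj_.
by move=> c x /=; have := mpath_peq (h c x); rewrite sh_.
Qed.

End Cofibration.

Theorem theorem10 (C : small_category) (A B X Y : presheaf C)
  (j : psh_hom A B) (p : psh_hom X Y)
  (hj : psh_cofibration j) (hp : psh_fibration p) :
  fibration (pullback_hom j p) /\
  (psh_acyclic j \/ psh_acyclic p -> acyclic (pullback_hom j p)).
Proof.
split.
  apply/fibrationP => phi [[u v] /= puvj] [/= phiu phiv].
  have [psi [phipsi psij ppsi]] := cofibration_lift_peq hj hp puvj phiu phiv.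
  by exists psi => //; apply: eq_exist => /=; rewrite psij ppsi.
move=> [acj|acp]; apply/acyclicP; split.
(* Every [b] is equivalent to some [j a], so equivalence after restriction along [j] suffices. *)
- move=> phi psi [/= eqj _] c b; have /acyclicP[_ /(_ b)[a jab]] := acj c.
  apply: peq_trans (pset_funP (phi c) (peq_sym jab)) _.
  exact: peq_trans (eqj c a) (pset_funP (psi c) jab).
(* The map [u r] restricts to [u] exactly, and [p u r = v j r] is equivalent to [v]. *)
- move=> [[u v] /= puvj]; have [r [rj jr]] := acyclic_cofibration_retraction hj acj.
  exists (psh_comp u r); split=> c x /=.
    have -> : r c (j c x) = x.
      exact: (congr1 (fun k : psh_hom _ _ => k c x) rj).
    exact: peq_refl.
  by rewrite (psh_comp_eq (r c x) puvj); exact: pset_funP (jr c x).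
- move=> phi psi [/= _ eqp] c b; have /acyclicP[inj _] := acp c.
  exact: inj (eqp c b).
(* For acyclic [p] the cofibration [j] lifts against [p] itself, giving a strict preimage of
   [(u, v)]. *)
- move=> [[u v] /= puvj]; have [h [hju phv]] := hj _ _ _ hp acp u v puvj.
  by exists h; split=> /=; [rewrite hju|rewrite phv]; exact: (@peq_refl (Hom _ _)).
Qed.
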